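(* Let $U$ be a fixed unitary operator on a complex separable Hilbert space $\mathcal{H}$, and let $\mathcal{H}_{\mathbb{R}}$, $\mathfrak{C}(\mathcal{H}_{\mathbb{R}})$ and the isometric isomorphism $X:\mathcal{H}\to\mathfrak{C}(\mathcal{H}_{\mathbb{R}})$ be constructed from $U$ as described in the context; for a bounded operator $A$ on $\mathcal{H}$ put $\widehat{A}=XAX^{-1}$. For a unitary operator $V$ on $\mathcal{H}$, the following are equivalent. (a) $V\in\mathfrak{O}_c(U)$. (b) $V=WU^*W^*$, where $W$ is an operator on $\mathcal{H}$ with $$\widehat{W}=\begin{bmatrix} W_r & -W_c \\ W_c & W_r \end{bmatrix},$$ where $W_r,W_c$ are real linear operators on $\mathcal{H}_{\mathbb{R}}$ satisfying $$W_r^\dagger=W_r,\quad W_c^\dagger=W_c,\quad W_rW_c=W_cW_r,\quad W_r^2+W_c^2=I.$$ (c) There are real linear operators $W_r,W_c$ on $\mathcal{H}_{\mathbb{R}}$ satisfying $W_r^\dagger=W_r$, $W_c^\dagger=W_c$, $W_rW_c=W_cW_r$, $W_r^2+W_c^2=I$ such that the operator $\widehat{V}$ on $\mathfrak{C}(\mathcal{H}_{\mathbb{R}})$ satisfies $\widehat{V}=\widehat{W}\,\widehat{U}^*\,\widehat{W}^*$, where $$\widehat{W}=\begin{bmatrix} W_r & -W_c \\ W_c & W_r \end{bmatrix}.$$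
   Context: A conjugation on a complex Hilbert space is an antilinear, isometric map $C$ with $C^2=I$; $\mathfrak{O}_c(U)=\{CUC: C\text{ a conjugation on }\mathcal{H}\}$. ''Operator'' means bounded operator. Construction. Let $U=\int_{\mathbb{T}}\xi\,dE(\xi)$ be the spectral representation of $U$, with spectral measure $E$ on the Borel sets $\mathcal{B}$ of $\mathbb{T}$. Fix an orthonormal (finite or infinite) sequence $(\mathbf{x}_k)_{k\ge1}$ in $\mathcal{H}$ such that $\mathcal{H}=\bigoplus_{k\ge1}\mathcal{H}(\mathbf{x}_k)$ (orthogonal sum), where $\mathcal{H}(\mathbf{x}_k)$ is the closed complex linear span of $\{E(\Omega)\mathbf{x}_k:\Omega\in\mathcal{B}\}$ (such a sequence always exists). Let $\mathcal{H}(\mathbf{x}_k)_{\mathbb{R}}$ be the closed real linear span of $\{E(\Omega)\mathbf{x}_k:\Omega\in\mathcal{B}\}$ and $\mathcal{H}_{\mathbb{R}}=\bigoplus_{k\ge1}\mathcal{H}(\mathbf{x}_k)_{\mathbb{R}}$. With the inner product of $\mathcal{H}$, which is real-valued on $\mathcal{H}_{\mathbb{R}}$, this is a real Hilbert space, and every $\mathbf{h}\in\mathcal{H}$ is uniquely $\mathbf{h}=\mathbf{h}_r+i\mathbf{h}_c$ with $\mathbf{h}_r,\mathbf{h}_c\in\mathcal{H}_{\mathbb{R}}$. $\mathfrak{C}(\mathcal{H}_{\mathbb{R}})$ is the set of columns $\begin{bmatrix} \mathbf{h}_r \\ \mathbf{h}_c \end{bmatrix}$, $\mathbf{h}_r,\mathbf{h}_c\in\mathcal{H}_{\mathbb{R}}$,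 with componentwise addition, complex scalar multiplication $(s+it)\begin{bmatrix} \mathbf{h}_r \\ \mathbf{h}_c \end{bmatrix}=\begin{bmatrix} s\mathbf{h}_r-t\mathbf{h}_c \\ s\mathbf{h}_c+t\mathbf{h}_r \end{bmatrix}$, and inner product $\left\langle\begin{bmatrix} \mathbf{h}_r \\ \mathbf{h}_c \end{bmatrix},\begin{bmatrix} \mathbf{g}_r \\ \mathbf{g}_c \end{bmatrix}\right\rangle=\langle\mathbf{h}_r,\mathbf{g}_r\rangle+\langle\mathbf{h}_c,\mathbf{g}_c\rangle+i(\langle\mathbf{h}_c,\mathbf{g}_r\rangle-\langle\mathbf{h}_r,\mathbf{g}_c\rangle)$; it is a complex Hilbert space. $X:\mathcal{H}\to\mathfrak{C}(\mathcal{H}_{\mathbb{R}})$ is the isometric isomorphism $X(\mathbf{h}_r+i\mathbf{h}_c)=\begin{bmatrix} \mathbf{h}_r \\ \mathbf{h}_c \end{bmatrix}$. For a bounded real linear operator $A$ on $\mathcal{H}_{\mathbb{R}}$, $A^\dagger$ is its real adjoint: $\langle A\mathbf{x},\mathbf{y}\rangle=\langle\mathbf{x},A^\dagger\mathbf{y}\rangle$ for all $\mathbf{x},\mathbf{y}\in\mathcal{H}_{\mathbb{R}}$. A $2\times2$ matrix of real linear operators on $\mathcal{H}_{\mathbb{R}}$ acts on columns by the usual matrix multiplication. *)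

(* Defs.v *)
From HB Require Import structures.
From mathcomp Require Import all_boot all_order all_algebra.
From mathcomp Require Import complex.
From mathcomp Require Import all_classical all_reals all_analysis.
Set Implicit Arguments.
Unset Strict Implicit.
Unset Printing Implicit Defensive.
Import Order.TTheory GRing.Theory Num.Theory.
Import numFieldNormedType.Exports.
Local Open Scope classical_set_scope.
Local Open Scope ring_scope.
Local Open Scope complex_scope.

Definition separable (T : topologicalType) : Prop :=
  exists2 S : set T, countable S & dense S.

(* The three spaces involved (the complex Hilbert space, its real form, and the
   space of columns) all carry an R[i]-valued inner product [f], in terms of
   which boundedness and adjoints are expressed uniformly. *)

Section Operators.
Context {R : realType}.

Definition bounded_operator (T : Type) (f : T -> T -> R[i]) (A : T -> T) : Prop :=
  exists M : R, forall u, sqrtC (f (A u) (A u)) <= M%:C * sqrtC (f u u).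

Definition is_adjoint (T : Type) (f : T -> T -> R[i]) (A B : T -> T) : Prop :=
  forall u v, f (A u) v = f u (B v).

(* The adjoint, unique when [f] is an inner product.  The default value [id] is
   only taken by operators without adjoint, and these are never bounded
   operators on a Hilbert space. *)
Definition adjoint (T : Type) (f : T -> T -> R[i]) (A : T -> T) : T -> T :=
  if pselect (exists B, is_adjoint f A B) is left exB then sval (cid exB) else id.

Definition unitary (T : Type) (f : T -> T -> R[i]) (A : T -> T) : Prop :=
  [/\ bounded_operator f A, A \o adjoint f A =1 id & adjoint f A \o A =1 id].

End Operators.

Section Conjugations.
Context {R : realType} {H : completeNormedModType R[i]}.

Definition conjugation (C : H -> H) : Prop :=
  [/\ forall (a : R[i]) u v, C (a *: u + v) = Num.conj a *: C u + C v,
      forall u, `|C u| = `|u|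
    & C \o C =1 id].

Definition conjugates (U : H -> H) : set (H -> H) :=
  [set V | exists2 C, conjugation C & V = C \o U \o C].

End Conjugations.

Section Circle.
Context {R : realType}.

Definition circle : Type := {z : R[i] | `|z| == 1}.

HB.instance Definition _ := Choice.on circle.

Fact circle1_subproof : `|1 : R[i]| == 1.
Proof. by rewrite normr1. Qed.

HB.instance Definition _ :=
  isPointed.Build circle (exist _ 1 circle1_subproof).

(* The relative topology; [R[i]^o] carries the metric topology of [R[i]]. *)
Definition circle_open : set (set circle) :=
  [set (fun z : circle => sval z : R[i]^o) @^-1` O | O in open].

Definition borel_circle := g_sigma_algebraType circle_open.

HB.instance Definition _ := Measurable.on borel_circle.

End Circle.
Arguments circle : clear implicits.
Arguments borel_circle : clear implicits.

Section SpectralMeasure.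
Context {R : realType} {H : completeNormedModType R[i]}.
Variable ip : {dot H for Num.conj}.
(* Only the values of a spectral measure on Borel sets are meaningful. *)
Implicit Type E : set (borel_circle R) -> {linear H -> H}.

Definition spectral_measure E : Prop :=
  [/\ forall A, measurable A ->
        E A \o E A =1 E A /\ is_adjoint ip (E A) (E A),
      E setT =1 id,
      forall A B, measurable A -> measurable B -> E (A `&` B) =1 E A \o E B
    & forall F : (set (borel_circle R))^nat,
        (forall n, measurable (F n)) -> trivIset setT F ->
        forall h, series (fun n => E (F n) h) @ \oo --> E (\bigcup_n F n) h].

(* The finite positive Borel measure A |-> <E(A)h, h>. *)
Definition scalar_measure E (h : H) (A : set (borel_circle R)) : \bar R :=
  (complex.Re (ip (E A h) h))%:E.

(* U is the integral of xi dE(xi) in the weak sense: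
   <Uh, h> is the integral of xi d<E(xi)h, h> for all h, which determines U by
   polarization; the integral is split into its real and imaginary parts. *)
Definition spectral_representation (U : H -> H) E : Prop :=
  spectral_measure E /\
  forall h,
    (complex.Re (ip (U h) h))%:E =
      (\int[scalar_measure E h]_xi (complex.Re (sval xi))%:E)%E /\
    (complex.Im (ip (U h) h))%:E =
      (\int[scalar_measure E h]_xi (complex.Im (sval xi))%:E)%E.

End SpectralMeasure.

Section Spans.
Context {R : realType} {H : completeNormedModType R[i]}.

(* Linear combinations with coefficients in [K]; [K] is [predT] for the complex
   span and [Num.real] for the real span. *)
Definition lin_span (K : {pred R[i]}) (S : set H) : set H :=
  [set h | exists n (a : 'I_n -> R[i]) (s : 'I_n -> H),
     [/\ forall i, a i \in K, forall i, S (s i) & h = \sum_i a i *: s i]].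

Definition hilbert_sum (D : set nat) (M : nat -> set H) : set H :=
  [set h | exists f : H^nat,
     [/\ forall k, D k -> M k (f k), forall k, ~ D k -> f k = 0
       & series f @ \oo --> h]].

Variables (E : set (borel_circle R) -> {linear H -> H}) (x : H^nat).

Definition cyclic_space (K : {pred R[i]}) (k : nat) : set H :=
  closure (lin_span K [set E A (x k) | A in measurable]).

Variable ip : {dot H for Num.conj}.

(* A finite or infinite sequence is a function on [nat] restricted to an initial
   segment [D] of [nat]; its values outside [D] are ignored. *)
Definition cyclic_decomposition (D : set nat) : Prop :=
  [/\ forall j k, (j <= k)%N -> D k -> D j,
      forall j k, D j -> D k -> ip (x j) (x k) = (j == k)%:R,
      forall j k, D j -> D k -> j <> k ->
        forall u v, cyclic_space predT j u -> cyclic_space predT k v ->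
        ip u v = 0
    & hilbert_sum D (cyclic_space predT) = setT].

End Spans.

Section RealForm.
Context {R : realType} {H : completeNormedModType R[i]}.
Variables (E : set (borel_circle R) -> {linear H -> H}).
Variables (x : H^nat) (D : set nat).

Definition HR_set : set H := hilbert_sum D (cyclic_space E x Num.real).

Lemma cyclic_real_closed k (a : R[i]) u v : a \in Num.real ->
  cyclic_space E x Num.real k u -> cyclic_space E x Num.real k v ->
  cyclic_space E x Num.real k (a *: u + v).
Proof.
move=> ar Eu Ev B /= nB.
have /(_ B nB) : (a *: w.1 + w.2) @[w --> (u, v)] --> a *: u + v.
  by apply: cvgD; [apply: cvgZr; exact: cvg_fst|exact: cvg_snd].
case=> -[P Q] /= [nP nQ] PQB.
have [p [[m [b [s [bR Ss pE]]]] Pp]] := Eu _ nP.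
have [q [[n [c [t [cR St qE]]]] Qq]] := Ev _ nQ.
exists (a *: p + q); split; last exact: (PQB (p, q)).
exists (m + n)%N.
exists (fun i : 'I_(m + n) =>
  match fintype.split i with inl j => a * b j | inr j => c j end).
exists (fun i : 'I_(m + n) => match fintype.split i with inl j => s j | inr j => t j end).
split=> [i|i|]; [by case: (fintype.split i) => j //; rewrite realM | by case: (fintype.split i) |].
rewrite big_split_ord /= pE qE scaler_sumr; congr (_ + _).
  by apply: eq_bigr => i _; rewrite scalerA (unsplitK (inl i)).
by apply: eq_bigr => i _; rewrite (unsplitK (inr i)).
Qed.

Lemma HR_set_closed (a : R[i]) u v : a \in Num.real ->
  HR_set u -> HR_set v -> HR_set (a *: u + v).
Proof.
move=> ar [f [fM f0 fu]] [g [gM g0 gv]]; exists (a *: f + g); split=> [k Dk|k Dk|].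
- exact: cyclic_real_closed (fM _ Dk) (gM _ Dk).
- by rewrite /= -[LHS]/(a *: f k + g k) f0 // g0 // scaler0 addr0.
- by rewrite seriesD seriesZ; apply: cvgD => //; exact: cvgZr.
Qed.

Lemma HR_set0 : HR_set 0.
Proof.
exists (fun=> 0); split=> // [k _ B nB|].
  exists 0; split; last exact: nbhs_singleton.
  by exists 0%N, (fun=> 0), (fun=> 0); split=> [[]|[]|//]; rewrite ?big_ord0.
by rewrite /series /=; under eq_fun do rewrite big1 //; exact: cvg_cst.
Qed.

Definition HR_pred : {pred H} := [pred h | h \in HR_set].

Fact HR_pred_zmod_closed : zmod_closed HR_pred.
Proof.
split=> [|u v]; rewrite !inE; first exact: HR_set0.
move=> Hu Hv; rewrite addrC -scaleN1r; exact: HR_set_closed.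
Qed.

HB.instance Definition _ := GRing.isZmodClosed.Build H HR_pred HR_pred_zmod_closed.

Definition HR : Type := {h : H | HR_pred h}.

HB.instance Definition _ := [isSub of HR for @sval _ _].
HB.instance Definition _ := [Choice of HR by <:].
HB.instance Definition _ := [SubChoice_isSubZmodule of HR by <:].

Fact HR_scale_subproof (a : R) (u : HR) : HR_pred (a%:C *: val u).
Proof.
rewrite -[_ *: _]addr0 inE; apply: HR_set_closed; last exact: HR_set0.
- by rewrite complex_real.
- by have := valP u; rewrite inE.
Qed.

Definition HR_scale (a : R) (u : HR) : HR := Sub _ (HR_scale_subproof a u).

Fact HR_scaleA a b u : HR_scale a (HR_scale b u) = HR_scale (a * b) u.
Proof. by apply: val_inj; rewrite !SubK scalerA rmorphM. Qed.

Fact HR_scale1 : left_id 1 HR_scale.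
Proof. by move=> u; apply: val_inj; rewrite SubK scale1r. Qed.

Fact HR_scaleDr : right_distributive HR_scale +%R.
Proof. by move=> a u v; apply: val_inj; rewrite [RHS]raddfD /= scalerDr. Qed.

Fact HR_scaleDl u : {morph HR_scale^~ u : a b / a + b}.
Proof. by move=> a b; apply: val_inj; rewrite raddfD /= rmorphD scalerDl. Qed.

HB.instance Definition _ := GRing.Zmodule_isLmodule.Build R HR
  HR_scaleA HR_scale1 HR_scaleDr HR_scaleDl.

Definition column : Type := (HR * HR)%type.

HB.instance Definition _ := GRing.Zmodule.on column.

Definition column_scale (z : R[i]) (p : column) : column :=
  (complex.Re z *: p.1 - complex.Im z *: p.2,
   complex.Re z *: p.2 + complex.Im z *: p.1).

Fact column_scaleA a b p :
  column_scale a (column_scale b p) = column_scale (a * b) p.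
Proof.
case: a b p => [a1 a2] [b1 b2] [u v]; rewrite /column_scale /=.
congr (_, _).
- rewrite scalerBr scalerDr scalerBl scalerDl !scalerA !opprD !addrA.
  by rewrite addrAC; congr (_ + _); exact: addrAC.
- rewrite scalerBr scalerDr scalerBl scalerDl !scalerA.
  by rewrite [RHS]addrACA; congr (_ + _); exact: addrC.
Qed.

Fact column_scale1 : left_id 1 column_scale.
Proof.
by case=> u v; rewrite /column_scale /= !scale1r !scale0r subr0 addr0.
Qed.

Fact column_scaleDr : right_distributive column_scale +%R.
Proof.
move=> a [u v] [u' v']; rewrite /column_scale /=; congr (_, _);
  by rewrite !scalerDr ?opprD addrACA.
Qed.

Fact column_scaleDl p : {morph column_scale^~ p : a b / a + b}.
Proof.
move=> [a1 a2] [b1 b2]; case: p => [u v]; rewrite /column_scale /=.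
by congr (_, _); rewrite /= !scalerDl ?opprD addrACA.
Qed.

HB.instance Definition _ := GRing.Zmodule_isLmodule.Build R[i] column
  column_scaleA column_scale1 column_scaleDr column_scaleDl.

Variable ip : {dot H for Num.conj}.

(* The restriction of the inner product of [H]; it is real-valued. *)
Definition HR_ip (u v : HR) : R[i] := ip (val u) (val v).

Definition column_ip (p q : column) : R[i] :=
  HR_ip p.1 q.1 + HR_ip p.2 q.2 + 'i * (HR_ip p.2 q.1 - HR_ip p.1 q.2).

Definition of_column (p : column) : H := val p.1 + 'i *: val p.2.

(* The map X, i.e. the inverse of the bijection [of_column]. *)
Definition to_column (h : H) : column := xget 0 [set p | of_column p = h].

Definition hat (A : H -> H) : column -> column := to_column \o A \o of_column.

Definition block (Wr Wc : HR -> HR) (p : column) : column :=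
  (Wr p.1 - Wc p.2, Wc p.1 + Wr p.2).

Definition dagger (A : HR -> HR) : HR -> HR := adjoint HR_ip A.

Definition admissible_pair (Wr Wc : HR -> HR) : Prop :=
  [/\ bounded_operator HR_ip Wr /\ bounded_operator HR_ip Wc,
      dagger Wr =1 Wr,
      dagger Wc =1 Wc,
      Wr \o Wc =1 Wc \o Wr
    & forall u, Wr (Wr u) + Wc (Wc u) = u].

End RealForm.

(* Main.v *)
(* The real form carries the conjugation J (h_r + i h_c) = h_r - i h_c.  Each E(A)
   maps H_R into itself, hence commutes with J, and J is antilinear, so
   J U J = U^*.  For a conjugation C the operator W = C J is then unitary with
   W^* = J C and C U C = W (J U J) W^* = W U^* W^*; moreover J W J = W^*, which in
   terms of W = W_r + i W_c says that W_r and W_c are self-adjoint, and W W^* = I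
   gives the two remaining relations.  Conversely such a W makes C = W J a
   conjugation. *)
Require Import Defs.
From HB Require Import structures.
From mathcomp Require Import all_boot all_order all_algebra.
From mathcomp Require Import complex.
From mathcomp Require Import ring.
From mathcomp Require Import all_classical all_reals all_analysis.
Import Order.TTheory GRing.Theory Num.Theory.
Import numFieldNormedType.Exports.
Local Open Scope classical_set_scope.
Local Open Scope ring_scope.
Local Open Scope complex_scope.
Set Implicit Arguments.
Unset Strict Implicit.
Unset Printing Implicit Defensive.

(** * Adjoints with respect to an arbitrary form *)

Section Adjoints.
Context {R : realType} {T : Type}.
Variable f : T -> T -> R[i].
Implicit Types A B : T -> T.

(** [adjoint] selects some adjoint by choice; nondegeneracy in the second argument makes it unique,
    so exhibiting any adjoint computes it. *)
Lemma adjointE A B : (forall u v, (forall w, f w u = f w v) -> u = v) ->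
  is_adjoint f A B -> adjoint f A = B.
Proof.
move=> f_nondeg AB; rewrite /adjoint; case: pselect => [exB|]; last by case; exists B.
by apply/funext => v; apply: f_nondeg => w; rewrite -AB -(svalP (cid exB)).
Qed.

(* Without an adjoint, [adjoint f A] is [id], and [A =1 id] would have one. *)
Lemma adjointP A : (adjoint f A =1 id -> A =1 id) -> is_adjoint f A (adjoint f A).
Proof.
rewrite /adjoint; case: pselect => [exB _|noB /(_ (fun=> erefl)) A1].
  exact: svalP (cid exB).
by case: noB; exists id => u v; rewrite A1.
Qed.

End Adjoints.

(** Bundles an already constructed function, since the operators [W], [Wr] and [Wc] are required as
    linear maps. *)
Lemma linear_fun (K : nzRingType) (V W : lmodType K) (f : V -> W) :
  linear f -> exists g : {linear V -> W}, (g : V -> W) = f.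
Proof.
move=> lf; pose m := GRing.isLinear.Build K V W *:%R f lf.
by pose g : {linear V -> W} := HB.pack f m; exists g.
Qed.

(* [m1] and [m2] are bare set functions: nothing is known off the measurable sets. *)
Section IntegralCongruence.
Import HBNNSimple.

Lemma eq_measure_integral_fun d (T : measurableType d) (R : realType)
    (m1 m2 : set T -> \bar R) (f : T -> \bar R) :
  (forall A, measurable A -> m1 A = m2 A) ->
  (\int[m1]_x f x = \int[m2]_x f x)%E.
Proof.
move=> m12; rewrite /integral.
(* The integral of a simple function evaluates the set function only on level sets, which are
   measurable. *)
have sE (h : {nnsfun T >-> R}) : sintegral m1 h = sintegral m2 h.
  apply: eq_fsbigr => r _; congr (_ * _)%E; apply: m12; exact: measurable_sfunP.
by congr (ereal_sup _ - ereal_sup _)%E; apply/seteqP; split => _ [h hf <-];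
  exists h => //; rewrite sE.
Qed.

End IntegralCongruence.

(** * Polarization, pairs with real inner product, and limits of their combinations *)

Section InnerProduct.
Context {R : realType} {H : completeNormedModType R[i]}.
Variable ip : {dot H for Num.conj}.
Hypothesis ip_norm : forall h : H, `|h| = sqrtC (ip h h).

Lemma conj_i : Num.conj 'i = - 'i :> R[i].
Proof. by apply/eqP; rewrite eq_complex /= oppr0 !eqxx. Qed.

Lemma mul_ii : 'i * 'i = -1 :> R[i].
Proof. by rewrite -expr2 sqr_i. Qed.

Lemma i_neq0 : 'i != 0 :> R[i].
Proof. by rewrite eq_complex /= oner_eq0 andbF. Qed.

Lemma ipC u v : ip u v = Num.conj (ip v u).
Proof. by rewrite hermC expr0 mul1r. Qed.

Lemma ipDl u v w : ip (u + v) w = ip u w + ip v w.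
Proof. exact: linearDl. Qed.

Lemma ipDr u v w : ip u (v + w) = ip u v + ip u w.
Proof. exact: linearDr. Qed.

Lemma ipNl u v : ip (- u) v = - ip u v.
Proof. exact: linearNl. Qed.

Lemma ipNr u v : ip u (- v) = - ip u v.
Proof. exact: linearNr. Qed.

Lemma ipZl a u v : ip (a *: u) v = a * ip u v.
Proof. exact: linearZl_LR. Qed.

Lemma ipZr a u v : ip u (a *: v) = Num.conj a * ip u v.
Proof. exact: linearZr_LR. Qed.

Lemma ip_sqr h : ip h h = `|h| ^+ 2.
Proof. by rewrite ip_norm sqrtCK. Qed.

Lemma ip_nondeg (u v : H) : (forall w, ip w u = ip w v) -> u = v.
Proof.
move=> uv; apply/eqP; rewrite -subr_eq0 -normr_eq0 -sqrf_eq0 -ip_sqr.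
by rewrite ipDr ipNr uv subrr.
Qed.

(** Expanding [q (u + v) (u + v)] shows that [q] is skew; replacing [u] by ['i *: u] then shows that
    it is symmetric as well, hence zero. *)
Lemma polarization (q : H -> H -> R[i]) :
  (forall u v w, q (u + v) w = q u w + q v w) ->
  (forall u v w, q u (v + w) = q u v + q u w) ->
  (forall a u v, q (a *: u) v = a * q u v) ->
  (forall a u v, q u (a *: v) = Num.conj a * q u v) ->
  (forall u, q u u = 0) -> forall u v, q u v = 0.
Proof.
move=> qDl qDr qZl qZr q0 u v.
have skew a b : q a b = - q b a.
  have := q0 (a + b); rewrite qDl !qDr !q0 add0r addr0 => /eqP.
  by rewrite addr_eq0 => /eqP.
have : 'i * q u v = 'i * q v u by rewrite -qZl skew qZr conj_i mulNr opprK.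
move/(mulfI i_neq0) => e; have := skew u v; rewrite -e => /eqP.
by rewrite -addr_eq0 -mulr2n mulrn_eq0 => /eqP.
Qed.

Lemma antilinearP (C : H -> H) :
  (forall (a : R[i]) u v, C (a *: u + v) = Num.conj a *: C u + C v) ->
  (forall u v, C (u + v) = C u + C v) /\
  (forall a u, C (a *: u) = Num.conj a *: C u).
Proof.
move=> CP.
have CD u v : C (u + v) = C u + C v by have := CP 1 u v; rewrite rmorph1 !scale1r.
have C0 : C 0 = 0 by apply: (addrI (C 0)); rewrite -CD !addr0.
by split=> // a u; have := CP a u 0; rewrite C0 !addr0.
Qed.

(* Equivalently, [ip u v] is real. *)
Definition ip_sym u v := ip u v = ip v u.

Lemma ip_symDl u v w : ip_sym u w -> ip_sym v w -> ip_sym (u + v) w.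
Proof. by rewrite /ip_sym ipDl ipDr => -> ->. Qed.

Lemma ip_symZl a u v : a \in Num.real -> ip_sym u v -> ip_sym (a *: u) v.
Proof. by move=> /CrealP ar; rewrite /ip_sym ipZl ipZr ar => ->. Qed.

Lemma ip_sym_sum I (r : seq I) (P : pred I) (F : I -> H) v :
  (forall i, P i -> ip_sym (F i) v) -> ip_sym (\sum_(i <- r | P i) F i) v.
Proof.
move=> Fv; apply: (big_ind (ip_sym^~ v)) => // [|u w].
  by rewrite /ip_sym linear0l linear0r.
exact: ip_symDl.
Qed.

Lemma norm_addi u v :
  `|u + 'i *: v| ^+ 2 = `|u| ^+ 2 + `|v| ^+ 2 + 'i * (ip v u - ip u v).
Proof.
rewrite -!ip_sqr !(ipDl, ipDr, ipZl, ipZr) conj_i.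
transitivity (ip u u - ('i * 'i) * ip v v + 'i * (ip v u - ip u v)); first by ring.
by rewrite mul_ii; ring.
Qed.

(** Expresses the realness of [ip u v] through norms alone, so that its stability under limits
    follows from the continuity of the norm. *)
Lemma ip_symP u v : ip_sym u v <-> `|u + 'i *: v| ^+ 2 - `|u| ^+ 2 - `|v| ^+ 2 = 0.
Proof.
rewrite norm_addi; split => [->|]; first by ring.
rewrite /ip_sym => e.
have /eqP : 'i * (ip v u - ip u v) = 0 by rewrite -[RHS]e; ring.
by rewrite mulf_eq0 (negPf i_neq0) subr_eq0 => /eqP.
Qed.

(** For such a pair the mixed term of [norm_addi] vanishes, which leaves the Pythagorean
    identity. *)
Lemma norm_le_addi u v : ip_sym u v -> `|u| <= `|u + 'i *: v|.
Proof.
move=> uv; rewrite -ler_sqr ?nnegrE ?normr_ge0// norm_addi uv subrr mulr0 addr0.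
by rewrite lerDl exprn_ge0.
Qed.

Lemma norm_le_addi_r u v : ip_sym u v -> `|v| <= `|u + 'i *: v|.
Proof.
move=> uv; rewrite -ler_sqr ?nnegrE ?normr_ge0// norm_addi uv subrr mulr0 addr0.
by rewrite lerDr exprn_ge0.
Qed.

(** The differences [u - u'] and [v - v'] again form a symmetric pair, and both are bounded in norm
    by their combination, which is zero. *)
Lemma addi_inj u v u' v' : ip_sym u v -> ip_sym u v' -> ip_sym u' v ->
  ip_sym u' v' -> u + 'i *: v = u' + 'i *: v' -> u = u' /\ v = v'.
Proof.
move=> uv uv' u'v u'v' e.
have e0 : (u - u') + 'i *: (v - v') = 0.
  by rewrite scalerBr addrACA -opprD e subrr.
have s : ip_sym (u - u') (v - v').
  by rewrite /ip_sym !(ipDl, ipDr, ipNl, ipNr) uv uv' u'v u'v'; ring.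
by split; apply/eqP; rewrite -subr_eq0 -normr_le0 -(@normr0 _ H) -e0;
  [exact: norm_le_addi|exact: norm_le_addi_r].
Qed.

Lemma closed_ip_sym v : closed [set u | ip_sym u v].
Proof.
have -> : [set u | ip_sym u v] =
    (fun u : H => `|u + 'i *: v| ^+ 2 - `|u| ^+ 2 - `|v| ^+ 2 : R[i]^o) @^-1` [set 0].
  by apply/seteqP; split => u /= /ip_symP.
apply: preimage_closed; last exact: accessible_closed_set1 (hausdorff_accessible _) _.
move=> u _; apply: cvgB; last exact: cvg_cst.
apply: cvgB; last by apply: cvgM; exact: norm_continuous.
have c : `|w + 'i *: v| @[w --> u] --> (`|u + 'i *: v| : R[i]^o).
  by apply: cvg_norm; apply: cvgD; [exact: cvg_id|exact: cvg_cst].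
exact: cvgM.
Qed.

(** The closure is taken in one argument at a time; the second argument is reached by exchanging the
    roles of the two. *)
Lemma closure_ip_sym (S S' : set H) :
  (forall u v, S u -> S' v -> ip_sym u v) ->
  forall u v, closure S u -> closure S' v -> ip_sym u v.
Proof.
move=> SS.
have half (A B : set H) : (forall u v, A u -> B v -> ip_sym u v) ->
    forall u v, closure A u -> B v -> ip_sym u v.
  move=> AB u v Au Bv; apply: (@closed_ip_sym v); move: Au.
  by apply: closure_subset => w Aw; exact: AB.
move=> u v Su Sv; apply: (esym (half S' (closure S) _ v u Sv Su)).
by move=> {v Sv}v w Sv Sw; apply: esym; exact: half Sw Sv.
Qed.

Lemma lin_span_ip_sym (S : set H) : (forall u v, S u -> S v -> ip_sym u v) ->
  forall u v, lin_span Num.real S u -> lin_span Num.real S v -> ip_sym u v.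
Proof.
move=> SS u v [m [a [s [ar Ss ->]]]] [n [b [t [br St ->]]]].
apply: ip_sym_sum => i _; apply: esym; apply: ip_sym_sum => j _.
by apply: ip_symZl => //; apply: esym; apply: ip_symZl => //; exact: SS.
Qed.

(* By [norm_le_addi], the Cauchy property passes from [c] to its real and
   imaginary parts. *)
Lemma cvg_parts T (F : set_system T) (FF : ProperFilter F) (a b c : T -> H) h :
  (forall p q, ip_sym (a p) (b q)) ->
  (\forall p \near F, c p = a p + 'i *: b p) -> c @ F --> h ->
  exists ha hb, [/\ a @ F --> ha, b @ F --> hb & h = ha + 'i *: hb].
Proof.
move=> ab cE ch.
have subE p q : c p = a p + 'i *: b p -> c q = a q + 'i *: b q ->
    `|a p - a q| <= `|c p - c q| /\ `|b p - b q| <= `|c p - c q|.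
  move=> -> ->; rewrite opprD addrACA -scalerBr.
  have s : ip_sym (a p - a q) (b p - b q).
    by rewrite /ip_sym !(ipDl, ipDr, ipNl, ipNr) !ab; ring.
  by split; [exact: norm_le_addi|exact: norm_le_addi_r].
have cvg_of (d : T -> H) : (forall p q, c p = a p + 'i *: b p ->
    c q = a q + 'i *: b q -> `|d p - d q| <= `|c p - c q|) -> cvg (d @ F).
  move=> dc; apply: cauchy_cvg; apply: cauchy_exP => e e0.
  have e2 : 0 < e / 2 by rewrite divr_gt0.
  have near_h : \forall p \near F, c p = a p + 'i *: b p /\ `|h - c p| < e / 2.
    by apply: filterI => //; move/cvgrPdist_lt : ch; exact.
  have [p0 [p0E p0h]] := filter_ex near_h.
  exists (d p0); rewrite nbhs_filterE /=; apply: filterS near_h => p [pE ph].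
  rewrite /= -ball_normE /=; apply: le_lt_trans (dc _ _ p0E pE) _.
  rewrite (splitr e) -(subrKA h); apply: le_lt_trans (ler_normD _ _) _.
  by rewrite ltrD// distrC.
have ca : cvg (a @ F) by apply: cvg_of => p q pE qE; case: (subE _ _ pE qE).
have cb : cvg (b @ F) by apply: cvg_of => p q pE qE; case: (subE _ _ pE qE).
exists (lim (a @ F)), (lim (b @ F)); split=> //.
(* The limits of the two parts recombine to a limit of [c], which can only be [h]. *)
apply: (cvg_unique (@norm_hausdorff _ _)) ch _.
apply: (cvg_trans (near_eq_cvg _)); first by apply: filterS cE => p /= ->.
by apply: cvgD => //; exact: cvgZr.
Qed.

Lemma contraction_continuous (f : {linear H -> H}) :
  (forall h, `|f h| <= `|h|) -> continuous f.
Proof.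
move=> f1 h; apply/cvgrPdist_lt => e e0; near=> g.
rewrite -raddfB; apply: le_lt_trans (f1 _) _; near: g.
exact: cvgr_dist_lt.
Unshelve. all: by end_near. Qed.

(** Pythagoras for the orthogonal vectors [P h] and [h - P h]. With [contraction_continuous] it
    makes spectral projections continuous. *)
Lemma projection_le (P : {linear H -> H}) : P \o P =1 P -> is_adjoint ip P P ->
  forall h, `|P h| <= `|h|.
Proof.
move=> PP Padj h; rewrite -ler_sqr ?nnegrE// -!ip_sqr.
have -> : ip h h = ip (P h) (P h) + ip (h - P h) (h - P h).
  have e : ip (P h) h = ip (P h) (P h) by rewrite -Padj -[P (P h)]/((P \o P) h) PP.
  have e' : ip h (P h) = ip (P h) (P h) by rewrite -Padj e.
  by rewrite !(ipDl, ipDr, ipNl, ipNr) e e'; ring.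
by rewrite lerDl dnorm_ge0.
Qed.

End InnerProduct.

(** * The real form: real inner products and the splitting [h = u + 'i *: v] *)

Section RealSubspace.
Context {R : realType} {H : completeNormedModType R[i]}.
Variable ip : {dot H for Num.conj}.
Hypothesis ip_norm : forall h : H, `|h| = sqrtC (ip h h).

Lemma sub_lin_span (K K' : {pred R[i]}) (S : set H) : {subset K <= K'} ->
  lin_span K S `<=` lin_span K' S.
Proof.
by move=> KK _ [n [a [s [aK Ss ->]]]]; exists n, a, s; split=> // i; exact: KK.
Qed.

Lemma lin_span_split (S : set H) h : lin_span predT S h ->
  exists u v, [/\ lin_span Num.real S u, lin_span Num.real S v & h = u + 'i *: v].
Proof.
move=> [n [a [s [_ Ss ->]]]].
exists (\sum_i (complex.Re (a i))%:C *: s i), (\sum_i (complex.Im (a i))%:C *: s i).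
split; first by exists n, (fun i => (complex.Re (a i))%:C), s; split=> // i; rewrite complex_real.
  by exists n, (fun i => (complex.Im (a i))%:C), s; split=> // i; rewrite complex_real.
rewrite scaler_sumr -big_split /=; apply: eq_bigr => i _.
by rewrite scalerA -scalerDl -complexE.
Qed.

Lemma closure_lin_span_split (S : set H) h :
  (forall u v, S u -> S v -> ip_sym ip u v) -> closure (lin_span predT S) h ->
  exists u v, [/\ closure (lin_span Num.real S) u,
    closure (lin_span Num.real S) v & h = u + 'i *: v].
Proof.
move=> SS; rewrite closureEcvg => -[F FF [Fh FS]].
(* [cvg_parts] asks for symmetry at all points, so points off the complex span receive the default
   parts [0], which lie in the real span. *)
have /choice[ab abP] : forall p, exists uv : H * H,
    [/\ lin_span Num.real S uv.1, lin_span Num.real S uv.2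
      & lin_span predT S p -> p = uv.1 + 'i *: uv.2].
  move=> p; have [/lin_span_split[u [v [Su Sv pE]]]|nS] := pselect (lin_span predT S p).
    by exists (u, v).
  have S0 : lin_span Num.real S 0.
    by exists 0%N, (fun=> 0), (fun=> 0); split=> [[]|[]|//]; rewrite ?big_ord0.
  by exists (0, 0).
have [||u [v [au bv hE]]] := @cvg_parts _ _ ip ip_norm _ F FF (fst \o ab) (snd \o ab) id h _ _ Fh.
- by move=> p q; apply: (lin_span_ip_sym SS); [case: (abP p)|case: (abP q)].
- by apply: FS => p Sp /=; case: (abP p) => _ _; exact.
exists u, v; split=> //.
- apply: (closed_cvg (closure (lin_span Num.real S)) _ _ _ au); first exact: closed_closure.
  by apply: nearW => p; apply: subset_closure; case: (abP p).
- apply: (closed_cvg (closure (lin_span Num.real S)) _ _ _ bv); first exact: closed_closure.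
  by apply: nearW => p; apply: subset_closure; case: (abP p).
Qed.

Lemma closure_morph (f : H -> H) (S T : set H) : continuous f ->
  (forall u, S u -> T (f u)) -> forall u, closure S u -> closure T (f u).
Proof.
move=> fc ST u Su B nB; have [w [Sw Bw]] := Su _ (fc u _ nB).
by exists (f w); split=> //; exact: ST.
Qed.

Variable E : set (borel_circle R) -> {linear H -> H}.
Hypothesis E_spec : spectral_measure ip E.

Lemma specP A : measurable A -> E A \o E A =1 E A /\ is_adjoint ip (E A) (E A).
Proof. by case: E_spec => + _ _ _; exact. Qed.

Lemma specI A B h : measurable A -> measurable B -> E A (E B h) = E (A `&` B) h.
Proof. by case: E_spec => _ _ EI _ mA mB; rewrite EI. Qed.

Lemma spec_continuous A : measurable A -> continuous (E A).
Proof.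
move=> mA; have [EE Eadj] := specP mA.
exact: contraction_continuous (projection_le ip_norm EE Eadj).
Qed.

(** Both inner products equal that of [y] with the image of [y] under the projection of the
    intersection, which is symmetric in the two Borel sets. *)
Lemma spec_ip_sym y u v : [set E A y | A in measurable] u ->
  [set E A y | A in measurable] v -> ip_sym ip u v.
Proof.
move=> [A mA <-] [B mB <-].
by rewrite /ip_sym (specP mA).2 (specP mB).2 !specI// setIC.
Qed.

Variables (x : H^nat) (D : set nat).
Hypothesis x_dec : cyclic_decomposition E x ip D.

(** [E A] sends the generator [E B (x k)] to [E (A]&[B) (x k)], keeps real coefficients, and passes
    to the closure by continuity. *)
Lemma spec_cyclic_space A k u : measurable A ->
  cyclic_space E x Num.real k u -> cyclic_space E x Num.real k (E A u).
Proof.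
move=> mA; apply: closure_morph; first exact: spec_continuous.
move=> _ [n [a [s [ar Ss ->]]]]; exists n, a, (fun i => E A (s i)); split=> // [i|].
  by have [B mB <-] := Ss i; exists (A `&` B); [exact: measurableI|rewrite specI].
by rewrite linear_sum; apply: eq_bigr => i _; rewrite linearZZ.
Qed.

Lemma spec_HR A u : measurable A -> HR_set E x D u -> HR_set E x D (E A u).
Proof.
move=> mA [f [fM f0 fu]]; exists (E A \o f); split=> [k Dk|k Dk|].
- exact: spec_cyclic_space (fM _ Dk).
- by rewrite /= f0 ?raddf0.
- have -> : series (E A \o f) = E A \o series f.
    by apply/funext => n; rewrite /series /= raddf_sum.
  by apply: continuous_cvg => //; exact: spec_continuous.
Qed.

(** Realness of the inner product is checked on these finite sums and then extended to their
    closure, which contains the real form. *)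
Definition partial_sums : set H := [set h | exists (f : H^nat) n,
  [/\ forall k, D k -> cyclic_space E x Num.real k (f k),
      forall k, ~ D k -> f k = 0 & h = series f n]].

Lemma partial_sums_ip_sym u v : partial_sums u -> partial_sums v -> ip_sym ip u v.
Proof.
move=> [f [m [fM f0 ->]]] [g [n [gM g0 ->]]]; rewrite /series /=.
apply: ip_sym_sum => j _; apply: esym; apply: ip_sym_sum => k _.
have [Dj|nDj] := pselect (D j); last by rewrite /ip_sym f0 // linear0l linear0r.
have [Dk|nDk] := pselect (D k); last by rewrite /ip_sym g0 // linear0l linear0r.
(* Within one cyclic space symmetry comes from [spec_ip_sym]; for distinct indices both inner
   products vanish by orthogonality. *)
have [<-|/eqP jk] := eqVneq j k.
  apply: (closure_ip_sym ip_norm _ (gM _ _) (fM _ Dj)) => //.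
  exact: lin_span_ip_sym (@spec_ip_sym _).
have cplx i w : cyclic_space E x Num.real i w -> cyclic_space E x predT i w.
  by apply: closure_subset; exact: sub_lin_span.
have [_ _ orth _] := x_dec.
have fj := cplx _ _ (fM _ Dj); have gk := cplx _ _ (gM _ Dk).
by rewrite /ip_sym (orth _ _ Dj Dk jk _ _ fj gk) (orth _ _ Dk Dj (nesym jk) _ _ gk fj).
Qed.

Lemma HR_ip_sym u v : HR_set E x D u -> HR_set E x D v -> ip_sym ip u v.
Proof.
have sub w : HR_set E x D w -> closure partial_sums w.
  move=> [f [fM f0 fw]].
  apply: (closed_cvg (closure partial_sums) _ _ _ fw); first exact: closed_closure.
  by apply: nearW => n; apply: subset_closure; exists f, n.
move=> /sub Hu /sub Hv.
exact: (closure_ip_sym ip_norm partial_sums_ip_sym Hu Hv).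
Qed.

(** The terms of an expansion of [h] are split one by one; [cvg_parts] makes the two series of parts
    converge. *)
Lemma HR_split h : exists u v, [/\ HR_set E x D u, HR_set E x D v & h = u + 'i *: v].
Proof.
have [_ _ _ /seteqP[_ /(_ h I)[f [fM f0 fh]]]] := x_dec.
(* Off [D] both parts are chosen to be zero, as membership in [hilbert_sum] demands. *)
have /choice[ab abP] : forall k, exists uv : H * H,
    [/\ D k -> cyclic_space E x Num.real k uv.1,
        D k -> cyclic_space E x Num.real k uv.2,
        ~ D k -> uv = (0, 0) & f k = uv.1 + 'i *: uv.2].
  move=> k; have [Dk|nDk] := pselect (D k); last first.
    by exists (0, 0); split=> //; rewrite /= f0// scaler0 addr0.
  have [u [v [cu cv fE]]] := closure_lin_span_split (@spec_ip_sym (x k)) (fM _ Dk).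
  by exists (u, v).
have aM k : D k -> cyclic_space E x Num.real k (ab k).1 by case: (abP k).
have bM k : D k -> cyclic_space E x Num.real k (ab k).2 by case: (abP k).
have a0 k : ~ D k -> (ab k).1 = 0 by move=> nDk; case: (abP k) => _ _ ->.
have b0 k : ~ D k -> (ab k).2 = 0 by move=> nDk; case: (abP k) => _ _ ->.
have [||u [v [au bv hE]]] := cvg_parts ip_norm _ _ _ fh
  (a := series (fst \o ab)) (b := series (snd \o ab)).
- by move=> m n; apply: partial_sums_ip_sym; [exists (fst \o ab), m|exists (snd \o ab), n].
- apply: nearW => n; rewrite /series /= scaler_sumr -big_split /=.
  by apply: eq_bigr => k _; case: (abP k).
by exists u, v; split=> //; [exists (fst \o ab)|exists (snd \o ab)].
Qed.

End RealSubspace.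

(** * The isometry between columns and [H], and the conjugation [J] *)

Section Columns.
Context {R : realType} {H : completeNormedModType R[i]}.
Variable ip : {dot H for Num.conj}.
Hypothesis ip_norm : forall h : H, `|h| = sqrtC (ip h h).
Variable E : set (borel_circle R) -> {linear H -> H}.
Hypothesis E_spec : spectral_measure ip E.
Variables (x : H^nat) (D : set nat).
Hypothesis x_dec : cyclic_decomposition E x ip D.

Local Notation HR := (HR E x D).
Local Notation column := (column E x D).
Local Notation to_column := (@to_column R H E x D).
Local Notation of_column := (@of_column R H E x D).

Lemma HR_valP (u : HR) : HR_set E x D (val u).
Proof. by have := valP u; rewrite inE. Qed.

Lemma HR_val_sym (u v : HR) : ip_sym ip (val u) (val v).
Proof. exact: (HR_ip_sym ip_norm E_spec x_dec (HR_valP u) (HR_valP v)). Qed.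

Lemma HR_ipC (u v : HR) : HR_ip ip u v = HR_ip ip v u.
Proof. exact: HR_val_sym. Qed.

Lemma HR_ip_conj (u v : HR) : Num.conj (HR_ip ip u v) = HR_ip ip u v.
Proof. by rewrite /HR_ip -ipC; exact: HR_val_sym. Qed.

Lemma HR_ip_nondeg (u v : HR) : (forall w, HR_ip ip w u = HR_ip ip w v) -> u = v.
Proof.
move=> uv; apply: val_inj; apply/eqP.
rewrite -subr_eq0 -normr_eq0 -sqrf_eq0 -(ip_sqr ip_norm) ipDr ipNr.
by have := uv (u - v); rewrite /HR_ip [\val (u - v)]raddfB => ->; rewrite subrr.
Qed.

Lemma of_column_linear (a : R[i]) (p q : column) :
  of_column (a *: p + q) = a *: of_column p + of_column q.
Proof.
case: p q => [u v] [u' v']; case: a => [s t].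
rewrite -[LHS]/(s%:C *: val u - t%:C *: val v + val u' +
  'i *: (s%:C *: val v + t%:C *: val u + val v')).
rewrite -[RHS]/((s +i* t) *: (val u + 'i *: val v) + (val u' + 'i *: val v')).
rewrite [s +i* t]complexE /= !scalerDl !scalerDr !scalerA.
have -> : 'i * t%:C * 'i = - t%:C :> R[i] by rewrite mulrAC mul_ii mulN1r.
rewrite scaleNr [s%:C * 'i]mulrC [LHS]addrACA; congr (_ + _).
by rewrite [LHS]addrACA; congr (_ + _); rewrite addrC.
Qed.

Lemma of_column_ip p q : ip (of_column p) (of_column q) = column_ip ip p q.
Proof.
rewrite /of_column /column_ip /HR_ip !(ipDl, ipDr, ipZl, ipZr) conj_i.
set a := ip _ _; set b := ip _ _; set c := ip _ _; set d := ip _ _.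
transitivity (a - ('i * 'i) * d + 'i * (c - b)); first by ring.
by rewrite mul_ii /a /b /c /d; ring.
Qed.

Lemma of_column_inj : injective of_column.
Proof.
move=> [u v] [u' v'] /(addi_inj ip_norm) [] /=; do ?exact: HR_val_sym.
by move=> /val_inj -> /val_inj ->.
Qed.

Lemma of_columnK : cancel of_column to_column.
Proof. by move=> p; apply: xget_unique => // q /of_column_inj. Qed.

(** [HR_split] supplies a preimage of every vector, so the default value of [xget] in [to_column] is
    never taken for lack of one. *)
Lemma to_columnK : cancel to_column of_column.
Proof.
move=> h; have [u [v [Hu Hv ->]]] := HR_split ip_norm E_spec x_dec h.
apply: (@xgetPex _ 0 [set p | of_column p = _]).
have Pu : HR_pred E x D u by rewrite inE.
have Pv : HR_pred E x D v by rewrite inE.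
by exists (Sub u Pu, Sub v Pv).
Qed.

Lemma to_column_linear (a : R[i]) h g :
  to_column (a *: h + g) = a *: to_column h + to_column g.
Proof. by apply: of_column_inj; rewrite of_column_linear !to_columnK. Qed.

Lemma column_ip_nondeg (p q : column) :
  (forall r : column, column_ip ip r p = column_ip ip r q) -> p = q.
Proof.
move=> pq; apply: of_column_inj; apply: (ip_nondeg ip_norm) => h.
by rewrite -(to_columnK h) !of_column_ip.
Qed.

(** The conjugation [J] read on columns; [real_conj] is its transport to [H]. *)
Definition column_conj (p : column) : column := (p.1, - p.2).

Definition real_conj (h : H) : H := of_column (column_conj (to_column h)).

Lemma column_conjK : involutive column_conj.
Proof. by case=> u v; rewrite /column_conj /= opprK. Qed.

Lemma real_conjK : involutive real_conj.
Proof. by move=> h; rewrite /real_conj of_columnK column_conjK to_columnK. Qed.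

Lemma column_conj_antilinear (a : R[i]) (p q : column) :
  column_conj (a *: p + q) = Num.conj a *: column_conj p + column_conj q.
Proof.
case: a p q => [s t] [u v] [u' v'].
rewrite -[LHS]/(s *: u - t *: v + u', - (s *: v + t *: u + v')).
rewrite -[RHS]/(s *: u - (- t) *: (- v) + u', s *: (- v) + (- t) *: u - v') /=.
by rewrite !scalerN !scaleNr opprK !opprD.
Qed.

Lemma real_conj_antilinear (a : R[i]) h g :
  real_conj (a *: h + g) = Num.conj a *: real_conj h + real_conj g.
Proof. by rewrite /real_conj to_column_linear column_conj_antilinear of_column_linear. Qed.

(** The signs cancel in the real part and flip the imaginary part; symmetry of the real inner
    product turns this into exchanged arguments. *)
Lemma column_conj_ip p q :
  column_ip ip (column_conj p) (column_conj q) = column_ip ip q p.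
Proof.
case: p q => [u v] [u' v']; rewrite /column_ip /= /HR_ip !(raddfN val) /=.
rewrite !(ipNl, ipNr).
have := (HR_val_sym u u', HR_val_sym v v', HR_val_sym u v', HR_val_sym v u').
rewrite /ip_sym /= => -[[[-> ->] ->] ->]; ring.
Qed.

Lemma real_conj_ip h g : ip (real_conj h) (real_conj g) = ip g h.
Proof. by rewrite /real_conj of_column_ip column_conj_ip -of_column_ip !to_columnK. Qed.

End Columns.

(** * Adjoints through [J], and the antiunitarity of conjugations *)

Section Conjugate.
Context {R : realType} {H : completeNormedModType R[i]}.
Variable ip : {dot H for Num.conj}.
Hypothesis ip_norm : forall h : H, `|h| = sqrtC (ip h h).
Variable E : set (borel_circle R) -> {linear H -> H}.
Hypothesis E_spec : spectral_measure ip E.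
Variables (x : H^nat) (D : set nat).
Hypothesis x_dec : cyclic_decomposition E x ip D.

Local Notation HR := (HR E x D).
Local Notation column := (column E x D).
Local Notation to_column := (@to_column R H E x D).
Local Notation of_column := (@of_column R H E x D).
Local Notation column_conj := (@column_conj R H E x D).
Local Notation J := (@real_conj R H E x D).

Let of_columnK := of_columnK ip_norm E_spec x_dec.
Let to_columnK := to_columnK ip_norm E_spec x_dec.
Let to_column_linear := to_column_linear ip_norm E_spec x_dec.
Let real_conjK := real_conjK ip_norm E_spec x_dec.
Let real_conj_ip := real_conj_ip ip_norm E_spec x_dec.
Let column_conj_ip := column_conj_ip ip_norm E_spec x_dec.
Let column_ip_nondeg := column_ip_nondeg ip_norm E_spec x_dec.

Lemma real_conj_norm h : `|J h| = `|h|.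
Proof. by rewrite !ip_norm real_conj_ip. Qed.

Lemma real_conj_of_column p : J (of_column p) = of_column (column_conj p).
Proof. by rewrite /real_conj of_columnK. Qed.

(** [E A] is complex linear and preserves the real form, so it acts on the two components of a
    column separately. *)
Lemma spec_real_conj A h : measurable A -> E A (J h) = J (E A h).
Proof.
move=> mA; rewrite -(to_columnK h).
case: (to_column h) => u v; rewrite real_conj_of_column.
have Pu : HR_pred E x D (E A (val u)) by rewrite inE; exact/spec_HR/HR_valP.
have Pv : HR_pred E x D (E A (val v)) by rewrite inE; exact/spec_HR/HR_valP.
have EAD a b : E A (a + 'i *: b) = E A a + 'i *: E A b.
  by rewrite linearD linearZZ.
have -> : E A (of_column (u, v)) = of_column (Sub _ Pu, Sub _ Pv) by exact: EAD.
rewrite real_conj_of_column -[LHS]/(E A (val u + 'i *: - val v)) EAD.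
by rewrite linearN.
Qed.

(* [h] and [J h] have the same scalar spectral measure because [J] commutes with
   [E A], so [U] and the adjoint of [J U J] have the same quadratic form. *)
Lemma real_conj_adjoint (U : {linear H -> H}) :
  spectral_representation ip U E -> is_adjoint ip U (J \o U \o J).
Proof.
move=> [_ UE].
have UJ h : ip (U (J h)) (J h) = ip (U h) h.
  have mJ A : measurable A -> scalar_measure ip E (J h) A = scalar_measure ip E h A.
    move=> mA; rewrite /scalar_measure spec_real_conj//.
    by rewrite real_conj_ip (specP E_spec mA).2.
  have [[reJ imJ] [re im]] := (UE (J h), UE h).
  have reE : complex.Re (ip (U (J h)) (J h)) = complex.Re (ip (U h) h).
    by apply: EFin_inj; rewrite reJ re; exact: eq_measure_integral_fun.
  have imE : complex.Im (ip (U (J h)) (J h)) = complex.Im (ip (U h) h).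
    by apply: EFin_inj; rewrite imJ im; exact: eq_measure_integral_fun.
  by apply/eqP; rewrite eq_complex reE imE !eqxx.
have [JD JZ] := antilinearP (real_conj_antilinear ip_norm E_spec x_dec).
have UD a b : U (a + b) = U a + U b by exact: linearD.
have UZ a b : U (a *: b) = a *: U b by exact: linearZZ.
move=> u v; apply/eqP; rewrite -subr_eq0; apply/eqP.
(* The defect is sesquilinear because [J] occurs twice around [U]; on the diagonal it vanishes by
   [UJ]. *)
apply: (polarization (q := fun u v => ip (U u) v - ip u ((J \o U \o J) v))) => /=.
- by move=> a b c; rewrite UD !ipDl; ring.
- by move=> a b c; rewrite JD UD JD !ipDr; ring.
- by move=> a b c; rewrite UZ !ipZl; ring.
- by move=> a b c; rewrite JZ UZ JZ !ipZr !conjCK; ring.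
move=> h; rewrite -{3}(real_conjK h).
by rewrite real_conj_ip UJ subrr.
Qed.

(** Isometry gives the diagonal case. With the arguments exchanged the difference is sesquilinear,
    since [C] is antilinear, and polarization applies. *)
Lemma conjugation_ip (C : H -> H) : conjugation C ->
  forall u v, ip (C u) (C v) = ip v u.
Proof.
move=> [CD Cn _] u v.
have [{}CD CZ] := antilinearP CD.
apply/eqP; rewrite -subr_eq0; apply/eqP.
apply: (polarization (q := fun v u => ip (C u) (C v) - ip v u)) => /=.
- by move=> a b c; rewrite CD ipDr ipDl; ring.
- by move=> a b c; rewrite CD ipDl ipDr; ring.
- by move=> a b c; rewrite CZ ipZr ipZl conjCK; ring.
- by move=> a b c; rewrite CZ ipZr ipZl; ring.
by move=> h; rewrite !(ip_sqr ip_norm) Cn subrr.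
Qed.

Lemma of_hat (A : H -> H) p : of_column (hat A p) = A (of_column p).
Proof. by rewrite /hat /= to_columnK. Qed.

Lemma hat_adjoint (A B : H -> H) : is_adjoint ip A B ->
  is_adjoint (column_ip ip) (@hat R H E x D A) (hat B).
Proof. by move=> AB p q; rewrite -!of_column_ip !of_hat AB. Qed.

(** * From an admissible pair to a conjugation *)

Section Block.
Variables Wr Wc : {linear HR -> HR}.
Hypothesis W_admissible : admissible_pair ip Wr Wc.

Local Notation Wh := (block Wr Wc : column -> column).

(** [dagger] may be the default [id], but equality with the operator then makes the operator the
    identity, which is self-adjoint anyway. *)
Lemma admissible_sym : is_adjoint (HR_ip ip) Wr Wr /\ is_adjoint (HR_ip ip) Wc Wc.
Proof.
have [_ Wr_dag Wc_dag _ _] := W_admissible.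
have self (A : HR -> HR) : dagger ip A =1 A -> is_adjoint (HR_ip ip) A A.
  move=> dA; have Aadj : is_adjoint (HR_ip ip) A (adjoint (HR_ip ip) A).
    by apply: adjointP => A1 u; rewrite -dA /dagger A1.
  by move=> u v; rewrite Aadj -[adjoint _ _ _]/(dagger ip A v) dA.
by split; exact: self.
Qed.

(** Conjugating the block by [column_conj] changes the sign of [Wc]; by self-adjointness of both
    entries this is the adjoint. *)
Lemma block_adjoint :
  is_adjoint (column_ip ip) Wh (column_conj \o Wh \o column_conj).
Proof.
have [Wr_sym Wc_sym] := admissible_sym.
move=> [u v] [u' v'].
have dl a b c : HR_ip ip (a + b) c = HR_ip ip a c + HR_ip ip b c by exact: ipDl.
have nl a b : HR_ip ip (- a) b = - HR_ip ip a b by exact: ipNl.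
have dr a b c : HR_ip ip a (b + c) = HR_ip ip a b + HR_ip ip a c by exact: ipDr.
have nr a b : HR_ip ip a (- b) = - HR_ip ip a b by exact: ipNr.
rewrite /column_ip /= ![Wr (- _)]linearN ![Wc (- _)]linearN !(dl, nl, dr, nr) !Wr_sym !Wc_sym.
by ring.
Qed.

(** This is [W^* W = I]: formally [(Wr - i Wc)(Wr + i Wc)] has real part [Wr^2 + Wc^2], and its
    imaginary part is a commutator. *)
Lemma block_isometry p : column_conj (Wh (column_conj (Wh p))) = p.
Proof.
have [_ _ _ WC W1] := W_admissible.
case: p => u v; have [/= cu cv] := (WC u, WC v).
rewrite /block /column_conj /= ![Wr (- _)]linearN ![Wc (- _)]linearN.
rewrite ![Wr (_ + _)]linearD ![Wc (_ + _)]linearD ![Wr (- _)]linearN ![Wc (- _)]linearN !opprK.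
congr (_, _); first by rewrite -cv addrACA addNr addr0; exact: W1.
rewrite cu.
have aux (V : zmodType) (a b c : V) : - (a - b - (a + c)) = c + b.
  by rewrite opprB opprB addrC addrA subrK addrC.
by rewrite [LHS]aux; exact: W1.
Qed.


(** This is [W W^* = I], equivalently [(W J)^2 = I]; it follows from [W^* W = I] on conjugating by
    [J]. *)
Lemma block_conj_isometry p : Wh (column_conj (Wh (column_conj p))) = p.
Proof.
by rewrite -[LHS]column_conjK block_isometry column_conjK.
Qed.

Lemma block_linear (a : R[i]) p q : Wh (a *: p + q) = a *: Wh p + Wh q.
Proof.
case: a p q => [s t] [u v] [u' v'].
rewrite -[LHS]/(Wr (s *: u - t *: v + u') - Wc (s *: v + t *: u + v'),
  Wc (s *: u - t *: v + u') + Wr (s *: v + t *: u + v')).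
rewrite -[RHS]/(s *: (Wr u - Wc v) - t *: (Wc u + Wr v) + (Wr u' - Wc v'),
  s *: (Wc u + Wr v) + t *: (Wr u - Wc v) + (Wc u' + Wr v')).
have lin (A : {linear HR -> HR}) : (forall a b, A (a + b) = A a + A b) /\
    (forall a b, A (a *: b) = a *: A b) /\ (forall a, A (- a) = - A a).
  by split; [exact: linearD|split; [exact: linearZZ|exact: linearN]].
have [[rD [rZ rN]] [cD [cZ cN]]] := (lin Wr, lin Wc).
rewrite !(rD, rZ, rN, cD, cZ, cN) !scalerDr !scalerN !opprD.
have aux (V : zmodType) (b1 b2 b3 b4 b5 b6 : V) :
    b1 + b2 + b3 + (b4 + b5 + b6) = b1 + b4 + (b5 + b2) + (b3 + b6).
  by rewrite addrACA [_ + (b4 + b5)]addrACA [b2 + _]addrC.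
by congr (_, _); exact: aux.
Qed.

(** The conjugation is [C = W J], and [W (J U J) (J W J)] collapses to [C U C]. *)
Lemma block_conjugation (U V : H -> H) : is_adjoint ip U (J \o U \o J) ->
  hat V =1 Wh \o adjoint (column_ip ip) (hat U) \o adjoint (column_ip ip) Wh ->
  conjugates U V.
Proof.
move=> UJ VE; exists (of_column \o Wh \o column_conj \o to_column).
  split=> [a h g|h|h] /=.
  - rewrite to_column_linear column_conj_antilinear block_linear.
    by rewrite of_column_linear.
  - rewrite !ip_norm of_column_ip block_adjoint /=.
    by rewrite block_isometry column_conj_ip -of_column_ip !to_columnK.
  - by rewrite of_columnK block_conj_isometry to_columnK.
apply/funext => h /=.
have := VE (to_column h); rewrite /= => /(congr1 of_column).
rewrite of_hat to_columnK => ->.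
rewrite (adjointE column_ip_nondeg block_adjoint).
rewrite (adjointE column_ip_nondeg (hat_adjoint UJ)).
by rewrite /hat /= /real_conj !of_columnK column_conjK.
Qed.


Lemma hat_factorization (U V W : H -> H) : is_adjoint ip U (J \o U \o J) ->
  hat W =1 Wh -> V =1 W \o adjoint ip U \o adjoint ip W ->
  hat V =1 Wh \o adjoint (column_ip ip) (hat U) \o adjoint (column_ip ip) Wh.
Proof.
move=> UJ WE VE p.
(* The adjoint of [W] is computed on columns, from [block_adjoint], and carried back to [H]. *)
have W_adj : is_adjoint ip W (of_column \o (column_conj \o Wh \o column_conj) \o to_column).
  move=> h g; rewrite -{1}(to_columnK h) -of_hat WE -{1}(to_columnK g).
  by rewrite of_column_ip block_adjoint -of_column_ip to_columnK.
apply: of_column_inj => //.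
rewrite of_hat VE (adjointE column_ip_nondeg block_adjoint).
rewrite (adjointE column_ip_nondeg (hat_adjoint UJ)).
rewrite (adjointE (ip_nondeg ip_norm) W_adj) (adjointE (ip_nondeg ip_norm) UJ) /=.
by rewrite -(WE (hat _ _)) !of_hat /= !of_columnK.
Qed.

End Block.

(** * From a conjugation to an admissible pair *)

Lemma eq_addi (a b c d : R[i]) : Num.conj a = a -> Num.conj b = b ->
  Num.conj c = c -> Num.conj d = d -> a + 'i * b = c + 'i * d -> a = c /\ b = d.
Proof.
have conjE (z : R[i]) : Num.conj z = z -> z = (complex.Re z)%:C.
  case: z => s t /eqP; rewrite eq_complex /= => /andP[_].
  by rewrite eq_sym -addr_eq0 -mulr2n mulrn_eq0 => /eqP ->.
move=> /conjE -> /conjE -> /conjE -> /conjE -> /eqP.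
rewrite eq_complex /= !(mul0r, mul1r, mulr0, addr0, add0r, subr0) => /andP[/eqP -> /eqP ->].
by [].
Qed.

(** [J] fixes the real form, so [C J] agrees there with [C]; the entries [Wr] and [Wc] are the two
    components of [C] on it. *)
Lemma conjugation_block (C : H -> H) : conjugation C ->
  exists Wr Wc : {linear HR -> HR},
    admissible_pair ip Wr Wc /\ hat (C \o J) =1 block Wr Wc.
Proof.
move=> Cconj; have [CD Cn CC] := Cconj; have Cip := conjugation_ip Cconj.
have [CDD CZ] := antilinearP CD.
have CZi u v : C (u + 'i *: v) = C u - 'i *: C v by rewrite CDD CZ conj_i scaleNr.
pose c (u : HR) := to_column (C (val u)).
have c_lin (a : R) u v : c (a *: u + v) = a%:C *: c u + c v.
  rewrite /c -to_column_linear -[val _]/(a%:C *: val u + val v) CD.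
  by congr (to_column (_ *: _ + _)); apply/eqP; rewrite eq_complex /= oppr0 !eqxx.
have scaleE (a : R) (p : column) : a%:C *: p = (a *: p.1, a *: p.2).
  by rewrite -[LHS]/(a *: p.1 - 0 *: p.2, a *: p.2 + 0 *: p.1) !scale0r subr0 addr0.
have [|Wr WrE] := @linear_fun R HR HR (fun u => (c u).1).
  by move=> a u v; rewrite c_lin scaleE.
have [|Wc WcE] := @linear_fun R HR HR (fun u => (c u).2).
  by move=> a u v; rewrite c_lin scaleE.
have WE u : C (val u) = val (Wr u) + 'i *: val (Wc u).
  by rewrite WrE WcE -[RHS]/(of_column (c u)) to_columnK.
have W_sym : forall u v, HR_ip ip (Wr u) v = HR_ip ip u (Wr v) /\
    HR_ip ip (Wc u) v = HR_ip ip u (Wc v).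
  move=> u v.
  (* As [C] is involutive, this says that the inner product of [C u] with [v] equals that of [C v]
     with [u]; its real and imaginary parts give the two symmetries. *)
  have := Cip (val u) (C (val v)).
  rewrite -[C (C _)]/((C \o C) _) CC !WE !ipDl !ipZl.
  rewrite -!/(HR_ip ip _ _) => /eq_addi.
  have s := HR_ipC ip_norm E_spec x_dec.
  rewrite (s u (Wr v)) (s u (Wc v)); apply; exact: (HR_ip_conj ip_norm E_spec x_dec).
have W_bounded (A : HR -> HR) : (forall u, `|val (A u)| <= `|C (val u)|) ->
    bounded_operator (HR_ip ip) A.
  move=> AC; exists 1 => u; rewrite -!ip_norm mul1r.
  by rewrite -(Cn (val u)).
exists Wr, Wc; split; last first.
  move=> p; apply: (of_column_inj ip_norm E_spec x_dec).
  rewrite of_hat /= real_conj_of_column.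
  rewrite -[of_column (column_conj p)]/(val p.1 + 'i *: - val p.2) CZi.
  have -> : C (- val p.2) = - C (val p.2) by rewrite -scaleN1r CZ rmorphN1 scaleN1r.
  rewrite scalerN opprK !WE scalerDr scalerA mul_ii scaleN1r.
  rewrite -[RHS]/(val (Wr p.1) - val (Wc p.2) + 'i *: (val (Wc p.1) + val (Wr p.2))).
  by rewrite scalerDr [RHS]addrACA; congr (_ + _); rewrite addrC.
(* Both relations are the components of [C (C u) = u], expanded with [C] antilinear. *)
have W2 u : u = Wr (Wr u) + Wc (Wc u) /\ 0 = Wc (Wr u) - Wr (Wc u).
  have CCu : C (C (val u)) = val u by rewrite -[LHS]/((C \o C) _) CC.
  suff : (u, 0 : HR) = (Wr (Wr u) + Wc (Wc u), Wc (Wr u) - Wr (Wc u)).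
    by move=> e; split; [exact: (congr1 fst e)|exact: (congr1 snd e)].
  apply: (of_column_inj ip_norm E_spec x_dec).
  rewrite -[LHS]/(val u + 'i *: 0) scaler0 addr0 -{1}CCu WE CZi !WE.
  rewrite -[RHS]/(val (Wr (Wr u)) + val (Wc (Wc u)) +
    'i *: (val (Wc (Wr u)) - val (Wr (Wc u)))).
  rewrite !scalerDr scalerN opprD scalerA mul_ii scaleN1r opprK.
  by rewrite [RHS]addrACA; congr (_ + _); rewrite addrC.
split.
- split; apply: W_bounded => u; rewrite WE.
    exact/(norm_le_addi ip_norm)/HR_val_sym.
  exact/(norm_le_addi_r ip_norm)/HR_val_sym.
- by move=> u; rewrite /dagger (adjointE _ (fun u v => (W_sym u v).1)) //; exact: HR_ip_nondeg.
- by move=> u; rewrite /dagger (adjointE _ (fun u v => (W_sym u v).2)) //; exact: HR_ip_nondeg.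
- by move=> u; apply/esym/eqP; rewrite -subr_eq0 -(W2 u).2.
- by move=> u; rewrite -(W2 u).1.
Qed.

End Conjugate.

Theorem theorem6p18
  (R : realType) (H : completeNormedModType R[i])
  (ip : {dot H for Num.conj})
  (ip_norm : forall h : H, `|h| = sqrtC (ip h h))
  (H_separable : separable H)
  (U : {linear H -> H}) (U_unitary : unitary ip U)
  (E : set (borel_circle R) -> {linear H -> H})
  (E_U : spectral_representation ip U E)
  (D : set nat) (x : nat -> H)
  (x_decomposition : cyclic_decomposition E x ip D)
  (V : {linear H -> H}) (V_unitary : unitary ip V) :
  [<-> (V : H -> H) \in conjugates U;

       exists W : {linear H -> H},
         [/\ bounded_operator ip W,
             V =1 W \o adjoint ip U \o adjoint ip W
           & exists Wr Wc : {linear HR E x D -> HR E x D},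
               admissible_pair ip Wr Wc /\ hat W =1 block Wr Wc];

       exists Wr Wc : {linear HR E x D -> HR E x D},
         admissible_pair ip Wr Wc /\
         let Uh : column E x D -> column E x D := hat U in
         let Wh : column E x D -> column E x D := block Wr Wc in
         hat V =1 Wh \o adjoint (column_ip ip) Uh \o adjoint (column_ip ip) Wh].
Proof.
have [E_spec _] := E_U.
have UJ := real_conj_adjoint ip_norm E_spec x_decomposition E_U.
set J := real_conj E x D in UJ.
have JJ : involutive J := real_conjK ip_norm E_spec x_decomposition.
have J_ip := real_conj_ip ip_norm E_spec x_decomposition.
tfae.
(* The operator is [W = C J], linear as a composite of two antilinear maps. *)
- rewrite inE => -[C Cconj VE]; have [CD Cn CC] := Cconj.
  have [|W WE] := @linear_fun _ H H (C \o J).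
    move=> a h g; rewrite /= /J (real_conj_antilinear ip_norm E_spec x_decomposition).
    by rewrite CD conjCK.
  exists W; rewrite WE; split; last exact: conjugation_block.
    by exists 1 => h; rewrite mul1r -!ip_norm /= Cn (real_conj_norm ip_norm E_spec x_decomposition).
  have W_adj : is_adjoint ip (C \o J) (J \o C).
    move=> h g; rewrite -[in LHS](CC g) /= (conjugation_ip ip_norm Cconj).
    by rewrite -[in LHS](JJ (C g)) J_ip.
  (* With both adjoints explicit the product is [C J (J U J) (J C)], which reduces to [C U C]. *)
  rewrite (adjointE (ip_nondeg ip_norm) W_adj) (adjointE (ip_nondeg ip_norm) UJ) => h.
  by rewrite VE /= !JJ.
- move=> [W [_ VE [Wr [Wc [W_adm WE]]]]]; exists Wr, Wc; split=> //=.
  exact: (hat_factorization ip_norm E_spec x_decomposition W_adm UJ WE VE).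
- move=> [Wr [Wc [W_adm /= VE]]]; rewrite inE.
  exact: (block_conjugation ip_norm E_spec x_decomposition W_adm UJ VE).
Qed.
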